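(* Let $d\ge3$ and let $\mathcal{I}^u\subset\mathbb{Z}^d$ be the random interlacement set at level $u$. If $u$ is large enough (depending on $d$), then $$\mathbb{P}\big[\text{there exists } f\in S \text{ with } f(n)\in\mathcal{I}^u\cap\mathbb{Z}^2 \text{ for all } n\in\mathbb{N}_0\big]=1,$$ where $\mathbb{Z}^2$ is identified with the plane $\mathbb{Z}^2\times\{0\}^{d-2}\subset\mathbb{Z}^d$.
   Context: $S$ is the set of oriented paths $f:\mathbb{N}_0\to\mathbb{Z}^2$ with $f(n+1)-f(n)\in\{(0,1),(1,0)\}$ for all $n\in\mathbb{N}_0=\{0,1,2,\dots\}$ (with arbitrary starting point $f(0)\in\mathbb{Z}^2$). For $d\ge3$ and $u\ge0$, the random interlacement set $\mathcal{I}^u$ at level $u$ (Sznitman) is the random subset of $\mathbb{Z}^d$ given by the trace of a Poissonian cloud of doubly-infinite simple random walk trajectories with intensity parameter $u$; its law is characterized by $\mathbb{P}[\mathcal{I}^u\cap K=\emptyset]=e^{-u\,\mathrm{cap}(K)}$ for all finite $K\subset\mathbb{Z}^d$, where $\mathrm{cap}(K)=\sum_{x\in K}P_x[\text{simple random walk does not return to }K\text{ at positive times}]$. *)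

(* Defs.v *)
From HB Require Import structures.
From mathcomp Require Import all_boot all_order all_algebra.
From mathcomp Require Import finmap.
From mathcomp Require Import all_classical all_reals all_analysis.

Set Implicit Arguments.
Unset Strict Implicit.
Unset Printing Implicit Defensive.

Import Order.TTheory GRing.Theory Num.Theory.

Local Open Scope classical_set_scope.
Local Open Scope ring_scope.

(* The lattice Z^d is 'rV[int]_d. *)

Definition nearest_neighbour (d : nat) (x y : 'rV[int]_d) : Prop :=
  \sum_(i < d) `|y 0 i - x 0 i| = 1.

(* X is a simple random walk on Z^d started at x, under the probability P:
   every nearest-neighbour path of n steps from x is followed during the first
   n steps with probability (2d)^-n. For n = 0 this says X 0 = x almost surely;
   as these weights sum to 1 for each n, the law of X is determined. *)
Definition simple_random_walk (R : realType) (d : nat) (disp : measure_display)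
    (W : measurableType disp) (P : probability W R)
    (X : nat -> W -> 'rV[int]_d) (x : 'rV[int]_d) : Prop :=
  (forall n y, measurable [set w | X n w = y]) /\
  (forall (n : nat) (g : nat -> 'rV[int]_d),
     g 0%N = x ->
     (forall k, (k < n)%N -> nearest_neighbour (g k) (g k.+1)) ->
     P [set w | forall k, (k <= n)%N -> X k w = g k]
       = ((2 * d)%N%:R^-1 ^+ n)%:E).

Definition capacity (R : realType) (d : nat) (disp : measure_display)
    (W : measurableType disp) (P_ : 'rV[int]_d -> probability W R)
    (X : nat -> W -> 'rV[int]_d) (K : {fset 'rV[int]_d}) : R :=
  \sum_(x <- K) fine (P_ x [set w | forall n, (0 < n)%N -> X n w \notin K]).

(* I is a random subset of Z^d (measurable for the product sigma-algebra on
   subsets of Z^d) with the law of the interlacement set at level u. The events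
   {I `&` K = set0}, K finite, form a pi-system generating that sigma-algebra,
   so the second clause determines the law of I. *)
Definition random_interlacement (R : realType) (d : nat)
    (cap : {fset 'rV[int]_d} -> R) (u : R) (disp : measure_display)
    (T : measurableType disp) (P : probability T R)
    (I : T -> set 'rV[int]_d) : Prop :=
  (forall x, measurable [set t | I t x]) /\
  (forall K : {fset 'rV[int]_d},
     P [set t | I t `&` [set` K] = set0] = (expR (- (u * cap K)))%:E).

Definition oriented_path (f : nat -> int * int) : Prop :=
  forall n, f n.+1 - f n = (0, 1) \/ f n.+1 - f n = (1, 0).

Definition plane_embedding (d : nat) (z : int * int) : 'rV[int]_d :=
  \row_(i < d) (if i == 0%N :> nat then z.1 else
                if i == 1%N :> nat then z.2 else 0).

(* Main.v *)
Require Import Defs.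
From HB Require Import structures.
From mathcomp Require Import all_boot all_order all_algebra.
From mathcomp Require Import finmap.
From mathcomp Require Import all_classical all_reals all_analysis.
From mathcomp Require Import zify ring lra.

(* In the coordinates s = x - y and t = x + y, consider dual paths in which the
   steps up and left, lowering s, are free, while the steps right and down,
   raising s, must cross an edge into a vacant site. The set of points reachable
   by dual paths is closed under the moves up and left, so its boundary is a
   staircase, and this staircase is an open oriented path unless dual paths
   connect every p to every p + (k, -k).

   Seen from its leftmost point, such a long dual path leaves a box of width 16^n
   and height 2 * 128^n other than through the left side, for some large n.
   A box crossing of this kind contains two far apart crossings at scale n - 1:
   the right exit forces both ends of the s-range to be crossed, and a path which
   only climbs cannot keep leaving smaller boxes through their left sides. Hence
   there are 2^n vacant sites, arranged as the leaves of a binary tree whose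
   branches at scale k are at distance at least 16^k, and there are at most
   Y^(2^n) such arrangements.

   The function G(x) = (100^2 + |x|^2)^(-1/4) is strictly superharmonic in
   dimension at least 3. A last exit decomposition bounds the capacity of K from
   below by c |K| / max_y sum_(x in K) G(x - y), and the maximum is bounded for
   the tree-like sets. So the 2^n sites are all vacant with probability at most
   exp(- u c 2^n), which beats Y^(2^n) when u is large; summing over n >= N and
   letting N tend to infinity shows that percolation fails with probability 0. *)

Set Implicit Arguments.
Unset Strict Implicit.
Unset Printing Implicit Defensive.

Import Order.TTheory GRing.Theory Num.Theory.
Import numFieldNormedType.Exports.

Local Open Scope classical_set_scope.
Local Open Scope ring_scope.

(** * Duality *)

(* The point (a, b) stands for the lower left corner (a - 1/2, b - 1/2) of the
   site (a, b), and V is the set of vacant sites. *)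
Definition dual_step (V : int * int -> Prop) (p q : int * int) : Prop :=
  [\/ q = (p.1, p.2 + 1), q = (p.1 - 1, p.2),
      q = (p.1 + 1, p.2) /\ V p | q = (p.1, p.2 - 1) /\ V q].

Definition dual_path (V : int * int -> Prop) (m : nat) (g : nat -> int * int) :=
  forall i, (i < m)%N -> dual_step V (g i) (g i.+1).

Definition dual_conn (V : int * int -> Prop) (p q : int * int) : Prop :=
  exists m g, [/\ g 0%N = p, g m = q & dual_path V m g].

Lemma dual_conn_step V p q q' :
  dual_conn V p q -> dual_step V q q' -> dual_conn V p q'.
Proof.
move=> [m [g [g0 gm gp]]] qq'.
exists m.+1, (fun i => if (i <= m)%N then g i else q'); split=> //=.
  by rewrite ltnn.
move=> i; rewrite ltnS leq_eqVlt => /orP[/eqP->|im] /=.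
  by rewrite eqxx ltnn gm.
by rewrite im orbT; apply: gp.
Qed.

(** Induction on [k]: if the point for [k] is reachable and the one for [k.+1] is not, the boundary
    of the reachable set passes between them, and following it from there gives an infinite oriented
    path of non-vacant sites. *)
Lemma duality V :
  ~ (exists f, oriented_path f /\ forall n, ~ V (f n)) ->
  forall (p : int * int) (k : nat), dual_conn V p (p.1 + k%:Z, p.2 - k%:Z).
Proof.
move=> noperc p k; elim: k => [|k IH].
  by exists 0%N, (fun=> p); split=> //; rewrite addr0 subr0; case: p.
apply: contrapT => nconn; apply: noperc.
pose Ga q := dual_conn V p q.
(* Walk along the boundary of Ga: the upper left corner of every visited site is
   in Ga and its lower right corner is not. *)
pose next (z : int * int) : int * int :=
  if pselect (Ga (z.1 + 1, z.2 + 1)) then (z.1 + 1, z.2) else (z.1, z.2 + 1).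
pose f n := iter n next (p.1 + k%:Z, p.2 - k%:Z - 1).
have inv n : Ga ((f n).1, (f n).2 + 1) /\ ~ Ga ((f n).1 + 1, (f n).2).
  elim: n => [|n [In1 In2]].
    rewrite /f /=; split; first by rewrite subrK.
    have -> : p.1 + k%:Z + 1 = p.1 + k.+1%:Z by lia.
    by have -> : p.2 - k%:Z - 1 = p.2 - k.+1%:Z by lia.
  rewrite [f _]iterS -/(f n) /next; case: pselect => /= h; split=> //.
    move=> h2; apply: In2; apply: dual_conn_step h2 _.
    by apply: Or42; rewrite /= addrK.
  by apply: dual_conn_step In1 _; apply: Or41.
exists f; split=> [n|n Vn].
  rewrite [f n.+1]iterS -/(f n) /next; case: (f n) => a b /=.
  by case: pselect => h; [right|left];
    congr pair; rewrite /= ?subrr ?[_ + 1]addrC ?addrK.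
(* If [f n] were vacant, its lower left corner would be reachable by a down step from the upper left
   one, and then the lower right corner by a right step. *)
have [In1 In2] := inv n.
have [In3|In3] := pselect (Ga (f n)).
  by apply: In2; apply: dual_conn_step In3 _; apply: Or43.
apply: In3; apply: dual_conn_step In1 _; apply: Or44.
by rewrite /= addrK; split=> //; case: (f n).
Qed.

(** * Box crossings of dual paths *)

Lemma first_time (p : pred nat) (i j : nat) : (i <= j)%N -> p j ->
  exists k, [/\ (i <= k <= j)%N, p k & forall l, (i <= l < k)%N -> ~~ p l].
Proof.
move=> ij pj; have ex : exists k, (i <= k)%N && p k by exists j; rewrite ij.
exists (ex_minn ex); case: ex_minnP => k /andP[ik pk] kmin; split=> //.
  by rewrite ik kmin// ij.
move=> l /andP[il lk]; apply/negP => pl.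
by have := kmin l; rewrite il pl => /(_ isT); rewrite leqNgt lk.
Qed.

Lemma last_time (p : pred nat) (i j : nat) : (i <= j)%N -> p i ->
  exists k, [/\ (i <= k <= j)%N, p k & forall l, (k < l <= j)%N -> ~~ p l].
Proof.
move=> ij pi; have ex : exists k, (i <= k <= j)%N && p k by exists i; rewrite leqnn ij.
have bd k : (i <= k <= j)%N && p k -> (k <= j)%N by case/andP => /andP[].
exists (ex_maxn ex bd); case: ex_maxnP => k /andP[ikj pk] kmax; split=> //.
move=> l /andP[kl lj]; apply/negP => pl.
have /kmax : (i <= l <= j)%N && p l by rewrite pl lj !andbT; lia.
by rewrite leqNgt kl.
Qed.

Definition unit_steps (s : nat -> int) (m : nat) : Prop :=
  forall i, (i < m)%N -> s i.+1 = s i + 1 \/ s i.+1 = s i - 1.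

Lemma last_visit (s : nat -> int) (m i j : nat) (c : int) :
  unit_steps s m -> (i <= j <= m)%N -> s i <= c < s j ->
  exists k, [/\ (i <= k < j)%N, s k = c & forall l, (k < l <= j)%N -> c < s l].
Proof.
move=> us /andP[ij jm] /andP[ic cj].
have [k [/andP[ik kj] pk kmax]] := @last_time (fun k => s k <= c) i j ij ic.
have kj' : (k < j)%N.
  by rewrite ltn_neqAle kj andbT; apply/eqP => kj'; move: pk cj; rewrite kj'; lia.
exists k; split=> //; first by rewrite ik.
  have := us k (leq_trans kj' jm).
  by have := kmax k.+1; rewrite leqnn kj' => /(_ isT); lia.
by move=> l /kmax; rewrite -ltNge.
Qed.

(** The ratio 128 = 34 + 60 + 34 of heights serves [crossing_split]. The initial height 2 keeps a
    single step at scale 0 from reaching the top or bottom. *)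
Definition box_width (n : nat) : nat := 16 ^ n.
Definition box_height (n : nat) : nat := 2 * 128 ^ n.

Lemma box_width0 : box_width 0 = 1%N. Proof. by []. Qed.
Lemma box_height0 : box_height 0 = 2%N. Proof. by []. Qed.
Lemma box_widthS n : box_width n.+1 = (16 * box_width n)%N.
Proof. exact: expnS. Qed.
Lemma box_heightS n : box_height n.+1 = (128 * box_height n)%N.
Proof. by rewrite /box_height expnS mulnCA. Qed.
Lemma box_width_gt0 n : (0 < box_width n)%N.
Proof. by rewrite expn_gt0. Qed.
Lemma box_width_height n : (box_width n < box_height n)%N.
Proof.
by elim: n => // n IH; rewrite box_widthS box_heightS; lia.
Qed.

(** The path starts at the centre of the box. Exits through the left side do not count, since free
    steps alone can produce them. *)
Definition box_crossing (s t : nat -> int) (n i j : nat) : Prop :=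
  let L := (box_width n)%:Z in let H := (box_height n)%:Z in
  [/\ (i <= j)%N,
      forall k, (i <= k <= j)%N ->
        [/\ s i - L <= s k, s k <= s i + L, t i - H <= t k & t k <= t i + H]
    & [\/ s j = s i + L, t j = t i + H | t j = t i - H]].

Lemma box_exit (s t : nat -> int) (m n i b : nat) :
  let L := (box_width n)%:Z in let H := (box_height n)%:Z in
  unit_steps s m -> unit_steps t m -> (i <= b <= m)%N ->
  [|| s b <= s i - L, s i + L <= s b, t b <= t i - H | t i + H <= t b] ->
  exists2 j, (i <= j <= b)%N & box_crossing s t n i j \/
    [/\ s j = s i - L, t i - H <= t j & t j <= t i + H].
Proof.
move=> L H us ut /andP[ib bm] out.
have := box_width_height n; have := box_width_gt0 n => L0 LH.
have [j [/andP[ij jb] pj jmin]] := @first_time (fun b =>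
  [|| s b <= s i - L, s i + L <= s b, t b <= t i - H | t i + H <= t b]) i b ib out.
have ij' : (i < j)%N.
  rewrite ltn_neqAle ij andbT; apply/eqP => ij'.
  by move: pj; rewrite -ij' /L /H; lia.
have box k : (i <= k < j)%N ->
    [/\ s i - L < s k, s k < s i + L, t i - H < t k & t k < t i + H].
  by move=> /jmin; rewrite !negb_or -!ltNge => /and4P[].
have boxj : [/\ s i - L <= s j, s j <= s i + L, t i - H <= t j & t j <= t i + H].
  have jm : (j.-1 < m)%N by lia.
  have := us _ jm; have := ut _ jm; rewrite prednK; last by lia.
  have [|b1 b2 b3 b4] := box j.-1; first by lia.
  by move=> ? ?; split; lia.
exists j; first by rewrite ij jb.
have [e|e] := eqVneq (s j) (s i - L).
  by right; case: boxj.
left; split=> //.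
  move=> k /andP[ik]; rewrite leq_eqVlt => /orP[/eqP->//|kj].
  by have [|? ? ? ?] := box k; [rewrite ik|split; lia].
have : (s j == s i + L) || (t j == t i + H) || (t j == t i - H).
  by case: boxj => ? ? ? ?; lia.
by case/orP => [/orP[]|] /eqP; [constructor 1|constructor 2|constructor 3].
Qed.

(* A path in the strip cannot leave more than q successive boxes through their
   left side, since each such exit lowers s by the width of the box. *)
Lemma crossing_in_strip (s t : nat -> int) (m n : nat) (sigma : int) :
  let L := (box_width n)%:Z in let H := (box_height n)%:Z in
  unit_steps s m -> unit_steps t m ->
  forall (q a b : nat), (a <= b <= m)%N ->
  (forall k, (a <= k <= b)%N -> sigma <= s k) -> s a < sigma + L *+ q ->
  (t a + H *+ q.+1 <= t b) || (t b <= t a - H *+ q.+1) ->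
  exists i j, [/\ (a <= i)%N, (j <= b)%N & box_crossing s t n i j].
Proof.
move=> L H us ut; elim=> [|q IH] a b /andP[ab bm] low sa tab.
  by have := low a; rewrite leqnn ab => /(_ isT); lia.
have Hge : 0 <= H *+ q.+1 by rewrite mulrn_wge0.
have [||j /andP[aj jb] [cr|[sj tj1 tj2]]] := @box_exit s t m n a b us ut.
- by rewrite ab.
- by move: tab; rewrite -/H mulrS; lia.
- by exists a, j.
have [||||i [k [ji kb cr]]] := IH j b.
- by rewrite jb.
- by move=> k /andP[jk kb]; apply: low; rewrite (leq_trans aj jk).
- by move: sa; rewrite sj -/L mulrS; lia.
- by move: tab tj1 tj2; rewrite -/H [H *+ q.+2]mulrS; lia.
by exists i, k; split=> //; apply: leq_trans aj ji.
Qed.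

Lemma crossing_from_leftmost (s t : nat -> int) (m n i b : nat) :
  let L := (box_width n)%:Z in let H := (box_height n)%:Z in
  unit_steps s m -> unit_steps t m -> (i <= b <= m)%N ->
  (forall k, (i <= k <= b)%N -> s i <= s k) ->
  [|| s i + L <= s b, t b <= t i - H | t i + H <= t b] ->
  exists2 j, (i <= j <= b)%N & box_crossing s t n i j.
Proof.
move=> L H us ut ib low out.
have [|j /andP[ij jb] [cr|[sj _ _]]] := @box_exit s t m n i b us ut ib.
- by rewrite -/L -/H out orbT.
- by exists j => //; rewrite ij.
have := low j; rewrite ij jb => /(_ isT).
by have := box_width_gt0 n; lia.
Qed.

(** For an exit to the right, the last visits to the levels [s i] and [s i + 15 * L] start two
    crossings, because the path then stays to the right of them. An exit through the top or bottom
    has 34 small heights at either end for [crossing_in_strip], and 60 in between. *)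
Lemma crossing_split (s t : nat -> int) (m n i j : nat) :
  unit_steps s m -> unit_steps t m -> (j <= m)%N ->
  box_crossing s t n.+1 i j ->
  exists i1 j1 i2 j2,
    [/\ (i <= i1)%N /\ (j1 <= j)%N, (i <= i2)%N /\ (j2 <= j)%N,
        box_crossing s t n i1 j1, box_crossing s t n i2 j2 &
        (s i1 + 15 * (box_width n)%:Z <= s i2) \/
        (t i1 + 60 * (box_height n)%:Z <= t i2) \/
        (t i2 + 60 * (box_height n)%:Z <= t i1)].
Proof.
move=> us ut jm [ij box]; rewrite box_widthS box_heightS.
have := box_width_height n; have := box_width_gt0 n => L0 LH.
set L := box_width n in L0 LH *; set H := box_height n in LH *.
move=> ex.
have sright : s j = s i + (16 * L)%N%:Z \/
   (t j = t i + (128 * H)%N%:Z \/ t j = t i - (128 * H)%N%:Z).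
  by case: ex; auto.
case: sright => [sj|tj].
  have [||k1 [/andP[ik1 k1j] sk1 k1l]] := @last_visit s m i j (s i) us.
  - by rewrite ij.
  - by lia.
  have [||k2 [/andP[ik2 k2j] sk2 k2l]] :=
    @last_visit s m i j (s i + 15 * L%:Z) us.
  - by rewrite ij.
  - by lia.
  have [|||j1 /andP[_ jj1] c1] := @crossing_from_leftmost s t m n k1 j us ut.
  - by rewrite (ltnW k1j).
  - move=> k /andP[]; rewrite leq_eqVlt => /orP[/eqP<-//|kk kj].
    by have := k1l k; rewrite kk kj => /(_ isT); lia.
  - by rewrite -/L; apply/orP; left; lia.
  have [|||j2 /andP[_ jj2] c2] := @crossing_from_leftmost s t m n k2 j us ut.
  - by rewrite (ltnW k2j).
  - move=> k /andP[]; rewrite leq_eqVlt => /orP[/eqP<-//|kk kj].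
    by have := k2l k; rewrite kk kj => /(_ isT); lia.
  - by rewrite -/L; apply/orP; left; lia.
  by exists k1, j1, k2, j2; split=> //; left; lia.
have split_up (t' : nat -> int) : unit_steps t' m ->
  (forall k, (i <= k <= j)%N ->
     s i - (16 * L)%N%:Z <= s k <= s i + (16 * L)%N%:Z) ->
  t' j = t' i + (128 * H)%N%:Z ->
  exists i1 j1 i2 j2,
    [/\ (i <= i1)%N /\ (j1 <= j)%N, (i <= i2)%N /\ (j2 <= j)%N,
        box_crossing s t' n i1 j1, box_crossing s t' n i2 j2 &
        t' i1 + 60 * H%:Z <= t' i2].
  move=> ut' strip t'j.
  have [|b [/andP[ib bj] tb bmin]] :=
    @first_time (fun k => t' i + 34 * H%:Z <= t' k) i j ij.
    by lia.
  have [|a [/andP[ia aj] ta amax]] :=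
    @last_time (fun k => t' k <= t' j - 34 * H%:Z) i j ij.
    by lia.
  (* The strip has width 32 * L, so [s] is always less than 33 * L from its left edge. *)
  have [||||i1 [j1 [ii1 j1b c1]]] :=
    @crossing_in_strip s t' m n (s i - (16 * L)%N%:Z) us ut' 33 i b.
  - by rewrite ib (leq_trans bj).
  - by move=> k /andP[ik kb];
    have := strip k; rewrite ik (leq_trans kb bj) => /(_ isT) /andP[].
  - by rewrite -/L; lia.
  - by rewrite -/H; apply/orP; left; lia.
  have [||||i2 [j2 [ai2 j2j c2]]] :=
    @crossing_in_strip s t' m n (s i - (16 * L)%N%:Z) us ut' 33 a j.
  - by rewrite aj.
  - by move=> k /andP[ak kj];
    have := strip k; rewrite (leq_trans ia ak) kj => /(_ isT) /andP[].
  - by have := strip a; rewrite ia aj -/L => /(_ isT); lia.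
  - by rewrite -/H; apply/orP; left; lia.
  have c1j := c1; have c2j := c2.
  exists i1, j1, i2, j2; split=> //.
  - by rewrite (leq_trans j1b bj).
  - by rewrite (leq_trans ia ai2).
  have [i1j1 _ _] := c1; have [i2j2 _ _] := c2.
  (* Before its first time [b] the level is not reached, and at [b] a unit step cannot overshoot
     it. *)
  have h1 : t' i1 <= t' i + 34 * H%:Z.
    have : (i1 <= b)%N by apply: leq_trans i1j1 j1b.
    rewrite leq_eqVlt => /orP[/eqP->|i1b]; last first.
      by have := bmin i1; rewrite ii1 i1b => /(_ isT); lia.
    have [bi|bi] := eqVneq b i; first by rewrite bi; lia.
    have b0 : b = b.-1.+1 by lia.
    have : ~~ (t' i + 34 * H%:Z <= t' b.-1) by apply: bmin; lia.
    have := ut' b.-1; rewrite -b0 => /(_ _) ub.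
    have {}ub : t' b = t' b.-1 + 1 \/ t' b = t' b.-1 - 1 by apply: ub; lia.
    by lia.
  have h2 : t' j - 34 * H%:Z <= t' i2.
    move: ai2; rewrite leq_eqVlt => /orP[/eqP<-|ai2]; last first.
      have := amax i2; rewrite ai2 (leq_trans i2j2 j2j) => /(_ isT); lia.
    have [bi|bi] := eqVneq a j; first by rewrite bi; lia.
    have aj' : (a < j)%N by rewrite ltn_neqAle bi.
    have := amax a.+1; rewrite leqnn aj' => /(_ isT).
    by have := ut' a (leq_trans aj' jm); lia.
  by lia.
have strip k : (i <= k <= j)%N ->
    s i - (16 * L)%N%:Z <= s k <= s i + (16 * L)%N%:Z.
  by move=> /box; rewrite box_widthS -/L => -[-> -> _ _].
case: tj => tj.
  have [i1 [j1 [i2 [j2 [h1 h2 c1 c2 h]]]]] := split_up t ut strip tj.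
  by exists i1, j1, i2, j2; split=> //; right; left.
(* An exit through the bottom is one through the top for the reflected path. *)
have [||i1 [j1 [i2 [j2 [h1 h2 c1 c2 h]]]]] := split_up (fun k => - t k) _ strip.
- by move=> k km; have := ut k km; lia.
- by lia.
have opp i' j' : box_crossing s (fun k => - t k) n i' j' -> box_crossing s t n i' j'.
  move=> [? b' e]; split=> //; first by move=> k /b'[? ? ? ?]; split; lia.
  by case: e => e; [constructor 1|constructor 3|constructor 2]; lia.
exists i1, j1, i2, j2; split=> //; [exact: opp|exact: opp|].
by right; right; move: h; rewrite -/H; lia.
Qed.

(** * Trees of vacant sites *)

Definition scoord (p : int * int) : int := p.1 - p.2.
Definition tcoord (p : int * int) : int := p.1 + p.2.

Definition centered (r : nat) : seq int := [seq k%:Z - r%:Z | k <- iota 0 r.*2.+1].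

Definition square (r : nat) (v : int * int) : seq (int * int) :=
  [seq (v.1 + a, v.2 + b) | a <- centered r, b <- centered r].

Lemma mem_centered (r : nat) (a : int) : (a \in centered r) = (- r%:Z <= a <= r%:Z).
Proof.
apply/mapP/idP => [[k]|ra]; first by rewrite mem_iota => kr ->; lia.
by exists (absz (a + r%:Z)); rewrite ?mem_iota; lia.
Qed.

Lemma mem_square (r : nat) (v z : int * int) :
  (z \in square r v) =
  (- r%:Z <= z.1 - v.1 <= r%:Z) && (- r%:Z <= z.2 - v.2 <= r%:Z).
Proof.
apply/allpairsP/andP => [[[a b] /= []]|[h1 h2]].
  by rewrite !mem_centered => ra rb -> /=; split; lia.
exists (z.1 - v.1, z.2 - v.2); rewrite /= !mem_centered; split=> //.
by case: z {h1 h2} => a b /=; congr pair; lia.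
Qed.

Lemma size_square r v : size (square r v) = (r.*2.+1 ^ 2)%N.
Proof. by rewrite size_allpairs size_map size_iota mulnn. Qed.

Definition far (n : nat) (z w : int * int) : bool :=
  ((box_width n)%:Z <= `|scoord z - scoord w|) ||
  ((box_width n)%:Z <= `|tcoord z - tcoord w|).

(* The distances 16^k between groups of 2^k sites are large enough to keep the
   total potential seen by any one of the sites bounded. *)
Fixpoint spread (n : nat) (l : seq (int * int)) : bool :=
  if n is n'.+1 then
    let l1 := take (2 ^ n') l in let l2 := drop (2 ^ n') l in
    [&& spread n' l1, spread n' l2 & allrel (far n') l1 l2]
  else size l == 1%N.

(** Here [v] stands for the start of a crossing at scale [n], and the square contains its box, hence
    the starts of the two smaller crossings. The radius 3 covers the vacant sites adjacent to a box
    at scale 0. *)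
Fixpoint trees (n : nat) (v : int * int) : seq (seq (int * int)) :=
  if n is n'.+1 then
    let ts := flatten [seq trees n' w | w <- square (box_height n'.+1) v] in
    [seq l1 ++ l2 | l1 <- ts, l2 <- ts]
  else [seq [:: z] | z <- square 3 v].


Arguments centered : simpl never.

Lemma mem_trees_cat n v w1 w2 l1 l2 :
  w1 \in square (box_height n.+1) v -> l1 \in trees n w1 ->
  w2 \in square (box_height n.+1) v -> l2 \in trees n w2 ->
  l1 ++ l2 \in trees n.+1 v.
Proof.
by move=> vw1 wl1 vw2 wl2; apply: allpairs_f; apply/flatten_mapP;
  [exists w1|exists w2].
Qed.

Lemma spread_size n l : spread n l -> size l = (2 ^ n)%N.
Proof.
elim: n l => [|n IH] l /=; first by move/eqP.
move=> /and3P[/IH h1 /IH h2 _].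
by rewrite -[l](cat_take_drop (2 ^ n)) size_cat h1 h2 addnn -mul2n expnS.
Qed.

Lemma spread_cat n l1 l2 : spread n l1 -> spread n l2 ->
  allrel (far n) l1 l2 -> spread n.+1 (l1 ++ l2).
Proof.
move=> s1 s2 f; rewrite /= -(spread_size s1) take_size_cat// drop_size_cat//.
exact/and3P.
Qed.

Lemma dual_path_unit_steps V m g : dual_path V m g ->
  unit_steps (scoord \o g) m /\ unit_steps (tcoord \o g) m.
Proof.
move=> gp; split=> i /gp; rewrite /scoord /tcoord /=.
  by case=> [->|->|[-> _]|[-> _]] /=; lia.
by case=> [->|->|[-> _]|[-> _]] /=; lia.
Qed.

Definition adjacent (z p : int * int) : bool :=
  (`|scoord z - scoord p| <= 1) && (`|tcoord z - tcoord p| <= 1).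

(** Two free steps in a row would leave the box, of width 1, through its left side, and one step
    does not reach the height 2. So one of the first two steps crosses into a vacant site. *)
Lemma crossing_vacant V m g i j : dual_path V m g -> (j <= m)%N ->
  box_crossing (scoord \o g) (tcoord \o g) 0 i j ->
  exists k z, [/\ (i <= k < j)%N, V z & adjacent z (g k)].
Proof.
move=> gp jm [ij box ex].
have step k : (k < m)%N -> scoord (g k.+1) = scoord (g k) - 1 \/
    exists z, V z /\ adjacent z (g k).
  move=> /gp; rewrite /scoord /adjacent /scoord /tcoord.
  case=> [->|->|[-> Vz]|[-> Vz]] /=; try by left; lia.
    by right; exists (g k); split=> //; lia.
  by right; exists ((g k).1, (g k).2 - 1); split=> //=; lia.
have [us ut] := dual_path_unit_steps gp.
have ij' : (i < j)%N.
  rewrite ltn_neqAle ij andbT; apply/eqP => ij'; move: ex.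
  by rewrite -ij' box_width0 box_height0; case; lia.
have [si|[z [Vz zi]]] := step i (leq_trans ij' jm); last first.
  by exists i, z; split=> //; rewrite leqnn.
have := ut i (leq_trans ij' jm); rewrite /= => ti.
have ij2 : (i.+1 < j)%N.
  rewrite ltn_neqAle ij' andbT; apply/eqP => ij2; move: ex.
  by rewrite -ij2 box_width0 box_height0 /=; case; lia.
have [si2|[z [Vz zi]]] := step i.+1 (leq_trans ij2 jm); last first.
  by exists i.+1, z; split=> //; rewrite leqnSn.
have := box i.+2; rewrite box_width0 box_height0 /= => -[|]; lia.
Qed.

(** Induction by [crossing_split]. The last clause ties the sites to the path, so that the
    separation of the two smaller crossings passes to their sites. *)
Lemma crossing_tree V m g n i j : dual_path V m g -> (j <= m)%N ->
  box_crossing (scoord \o g) (tcoord \o g) n i j ->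
  exists l, [/\ l \in trees n (g i), spread n l, forall z, z \in l -> V z &
    forall z, z \in l -> exists2 k, (i <= k <= j)%N & adjacent z (g k)].
Proof.
move=> gp; have [us ut] := dual_path_unit_steps gp.
elim: n i j => [|n IH] i j jm cr.
  have [k [z [/andP[ik kj] Vz zk]]] := crossing_vacant gp jm cr.
  exists [:: z]; split=> //.
  - apply/mapP; exists z => //; rewrite mem_square.
    have [_ box _] := cr; have := box k.
    rewrite ik (ltnW kj) box_width0 box_height0 => -[//|].
    by move: zk; rewrite /adjacent /scoord /tcoord /=; lia.
  - by move=> w; rewrite inE => /eqP->.
  - by move=> w; rewrite inE => /eqP->; exists k => //; rewrite ik ltnW.
have [i1 [j1 [i2 [j2 [[ii1 j1j] [ii2 j2j] c1 c2 sep]]]]] :=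
  crossing_split us ut jm cr.
have [l1 [t1 s1 V1 a1]] := IH _ _ (leq_trans j1j jm) c1.
have [l2 [t2 s2 V2 a2]] := IH _ _ (leq_trans j2j jm) c2.
have [_ box _] := cr.
have insq k : (i <= k <= j)%N -> g k \in square (box_height n.+1) (g i).
  move=> /box[]; rewrite mem_square /scoord /tcoord /=.
  by have := box_width_height n.+1; lia.
exists (l1 ++ l2); split.
- apply: (mem_trees_cat _ t1 _ t2); apply: insq.
    by rewrite ii1; case: c1 => h _ _; rewrite (leq_trans h j1j).
  by rewrite ii2; case: c2 => h _ _; rewrite (leq_trans h j2j).
(* Each site is within a width plus 1 in [s], and a height plus 1 in [t], of the start of its
   crossing; starts 15 widths or 60 heights apart leave more than enough. *)
- apply: spread_cat => //; apply/allrelP => z w /a1[k1 k1ij zk1] /a2[k2 k2ij wk2].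
  case: c1 => _ /(_ k1 k1ij) + _; case: c2 => _ /(_ k2 k2ij) + _.
  move: sep zk1 wk2; rewrite /far /adjacent /=.
  have := box_width_height n; have := box_width_gt0 n.
  by move=> L0 LH sep zk1 wk2 [? ? ? ?] [? ? ? ?]; lia.
- by move=> z; rewrite mem_cat => /orP[/V1|/V2].
- move=> z; rewrite mem_cat => /orP[/a1|/a2] [k /andP[ik kj] zk]; exists k => //.
    by rewrite (leq_trans ii1 ik) (leq_trans kj j1j).
  by rewrite (leq_trans ii2 ik) (leq_trans kj j2j).
Qed.

Lemma argmin_nat (s : nat -> int) (m : nat) :
  exists2 i, (i <= m)%N & forall k, (k <= m)%N -> s i <= s k.
Proof.
elim: m => [|m [i im ih]]; first by exists 0%N => // k; rewrite leqn0 => /eqP->.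
have [h|h] := leP (s i) (s m.+1).
  exists i; first by rewrite (leq_trans im).
  by move=> k; rewrite leq_eqVlt ltnS => /orP[/eqP->|/ih].
exists m.+1 => // k; rewrite leq_eqVlt ltnS => /orP[/eqP->//|/ih].
by move=> ?; apply: le_trans (ltW h) _.
Qed.

(** The crossing starts at the leftmost point of a long dual path from the origin. That point may be
    far away, so [n] is the least scale from [N] on whose next box about the origin contains it;
    minimality makes the end of the path lie outside the box of scale [n] about that point. *)
Lemma vacant_tree V N :
  ~ (exists f, oriented_path f /\ forall n, ~ V (f n)) ->
  exists n v l, [/\ (N <= n)%N, v \in square (box_height n.+1) (0, 0),
    l \in trees n v, spread n l & forall z, z \in l -> V z].
Proof.
move=> noperc.
have [m [g [g0 gm gp]]] := duality noperc (0, 0) (box_width N).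
have [us ut] := dual_path_unit_steps gp.
have [i im imin] := argmin_nat (scoord \o g) m.
have s0 : scoord (g 0%N) = 0 by rewrite g0.
have sm : scoord (g m) = (box_width N)%:Z *+ 2.
  by rewrite gm /scoord /=; lia.
have tm : tcoord (g m) = 0 by rewrite gm /tcoord /=; lia.
have si : scoord (g i) <= 0 by rewrite -s0; exact: imin.
have width_ge n : (n < box_width n)%N by rewrite ltn_expl.
pose small n := (- scoord (g i) < (box_width n.+1)%:Z) &&
  (`|tcoord (g i)| < (box_height n.+1)%:Z).
set M := (N + absz (scoord (g i)) + absz (tcoord (g i)))%N.
have smM : small M.
  have := width_ge M.+1; have := box_width_height M.+1.
  by rewrite /small /M; lia.
have NM : (N <= M)%N by rewrite /M -addnA leq_addr.
have [n [/andP[Nn _] /andP[smn smn'] nmin]] := @first_time small N M NM smM.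
have out : [|| scoord (g i) + (box_width n)%:Z <= scoord (g m),
    tcoord (g m) <= tcoord (g i) - (box_height n)%:Z |
    tcoord (g i) + (box_height n)%:Z <= tcoord (g m)].
  rewrite sm tm; move: Nn; rewrite leq_eqVlt => /orP[/eqP<-|Nn]; first by lia.
  have n1 : n = n.-1.+1 by lia.
  have : ~~ small n.-1 by apply: nmin; lia.
  by rewrite /small -n1; lia.
have low k : (i <= k <= m)%N -> (scoord \o g) i <= (scoord \o g) k.
  by move=> /andP[_]; exact: imin.
have [|j /andP[ij jm] cr] := @crossing_from_leftmost _ _ m n i m us ut _ low out.
- by rewrite im leqnn.
have [l [lt sl Vl _]] := crossing_tree gp jm cr.
exists n, (g i), l; split=> //; rewrite mem_square.
have := box_width_height n.+1; move: si smn smn'; rewrite /scoord /tcoord /=; lia.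
Qed.

(** In each step log (N n) / 2 ^ n increases by log (c n) / 2 ^ n, which is summable because [c]
    grows at most exponentially. *)
Lemma doubly_exponential_growth (c N : nat -> nat) (C q : nat) :
  (0 < C)%N -> (0 < q)%N -> (forall n, (c n <= C * q ^ n)%N) ->
  (forall n, N n.+1 = (c n * N n) ^ 2)%N ->
  exists2 Y, (0 < Y)%N & forall n, (c n * N n <= Y ^ (2 ^ n))%N.
Proof.
move=> C0 q0 cC NS.
(* The factor in Z is chosen to absorb [C * q ^ n] in [Z n.+1 <= Z n ^ 2]. *)
pose Z n := (C ^ 2 * (q ^ (n.+1)) ^ 2 * N n)%N.
have ZS n : (Z n.+1 <= Z n ^ 2)%N.
  rewrite /Z NS; apply: (@leq_trans (C ^ 2 * (q ^ n.+2) ^ 2 * (C * q ^ n * N n) ^ 2)).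
    by rewrite leq_mul2l leq_exp2r// leq_mul2r cC !orbT.
  rewrite !expnS !expn0 !muln1; move: (q ^ n)%N => x.
  by apply/eq_leq; ring.
have ZY n : (Z n <= (Z 0%N).+1 ^ (2 ^ n))%N.
  elim: n => [|n IH]; first by rewrite expn0 expn1.
  apply: leq_trans (ZS n) _.
  by rewrite [(2 ^ n.+1)%N]expnSr expnM leq_exp2r.
(* The successor keeps the base positive even when [N 0] is zero. *)
exists (Z 0%N).+1 => // n; apply: leq_trans (ZY n).
rewrite /Z leq_mul2r; apply/orP; right; apply: leq_trans (cC n) _.
have q1 : (0 < q ^ n)%N by rewrite expn_gt0 q0.
rewrite -expnMn -mulnn -[leqLHS]muln1 expnS.
by rewrite leq_mul ?muln_gt0 ?C0 ?q0// leq_mul2l leq_pmull ?orbT.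
Qed.

Lemma size_flatten_const (S T : Type) (F : S -> seq T) (s : seq S) (N : nat) :
  (forall x, size (F x) = N) -> size (flatten [seq F x | x <- s]) = (size s * N)%N.
Proof. by move=> FN; elim: s => //= x s IH; rewrite size_cat FN IH. Qed.

Lemma size_trees_center n v : size (trees n v) = size (trees n (0, 0)).
Proof.
case: n => [|n]; first by rewrite !size_map !size_square.
rewrite !size_allpairs !mulnn; congr (_ ^ 2)%N.
have [N sz] : exists N, forall w, size (trees n w) = N.
  elim: n => [|k [N IH]].
    by exists (3.*2.+1 ^ 2)%N => w; rewrite size_map size_square.
  exists (((box_height k.+1).*2.+1 ^ 2 * N) ^ 2)%N => w.
  by rewrite size_allpairs mulnn (size_flatten_const _ IH) size_square.
by rewrite !(size_flatten_const _ sz) !size_square.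
Qed.

Definition rooted_trees (n : nat) : seq (seq (int * int)) :=
  flatten [seq trees n v | v <- square (box_height n.+1) (0, 0)].

Lemma size_rooted_trees : exists2 Y, (0 < Y)%N & forall n,
  (size (rooted_trees n) <= Y ^ (2 ^ n))%N.
Proof.
(* As [box_height n.+1] is 256 * 128 ^ n, the side of the square is at most 513 * 128 ^ n. *)
have [||||Y Y0 hY] := @doubly_exponential_growth
  (fun n => (box_height n.+1).*2.+1 ^ 2)%N (fun n => size (trees n (0, 0)))
  (513 ^ 2) (128 ^ 2).
- by rewrite expn_gt0.
- by rewrite expn_gt0.
- move=> n; rewrite -expnM [(2 * n)%N]mulnC expnM -expnMn leq_exp2r//.
  rewrite box_heightS /box_height.
  by have : (0 < 128 ^ n)%N; [rewrite expn_gt0|lia].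
- move=> n; rewrite size_allpairs mulnn.
  by rewrite (size_flatten_const _ (size_trees_center n)) size_square.
exists Y => // n.
by rewrite (size_flatten_const _ (size_trees_center n)) size_square.
Qed.

(** * A superharmonic function *)

Definition walk_step (d : nat) (a : 'I_d * bool) : 'rV[int]_d :=
  if a.2 then delta_mx 0 a.1 else - delta_mx 0 a.1.

Definition walk_op (R : realType) (d : nat) (f : 'rV[int]_d -> R)
    (x : 'rV[int]_d) : R :=
  (2 * d)%N%:R^-1 * \sum_(a : 'I_d * bool) f (x + walk_step a).

Lemma walk_op_le (R : realType) (d : nat) (f g : 'rV[int]_d -> R) x :
  (forall y, f y <= g y) -> walk_op f x <= walk_op g x.
Proof. by move=> fg; rewrite ler_wpM2l ?invr_ge0// ler_sum. Qed.

Lemma walk_op_cst (R : realType) (d : nat) (c : R) x : (0 < d)%N ->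
  walk_op (fun _ : 'rV[int]_d => c) x = c.
Proof.
move=> d0; rewrite /walk_op sumr_const card_prod card_ord card_bool.
rewrite -[c *+ _]mulr_natl [(d * 2)%N]mulnC.
by rewrite mulKf// pnatr_eq0 muln_eq0 -lt0n d0.
Qed.

Lemma walk_opD (R : realType) (d : nat) (f g : 'rV[int]_d -> R) x :
  walk_op (fun y => f y + g y) x = walk_op f x + walk_op g x.
Proof. by rewrite /walk_op big_split mulrDr. Qed.

Lemma walk_opZ (R : realType) (d : nat) (c : R) (f : 'rV[int]_d -> R) x :
  walk_op (fun y => c * f y) x = c * walk_op f x.
Proof. by rewrite /walk_op -mulr_sumr mulrCA. Qed.

Lemma walk_op_sum (R : realType) (d : nat) (I : Type) (s : seq I)
    (f : I -> 'rV[int]_d -> R) x :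
  walk_op (fun y => \sum_(i <- s) f i y) x = \sum_(i <- s) walk_op (f i) x.
Proof. by rewrite /walk_op exchange_big mulr_sumr. Qed.

Lemma walk_op_shift (R : realType) (d : nat) (f : 'rV[int]_d -> R) x z :
  walk_op (fun y => f (y - z)) x = walk_op f (x - z).
Proof. by congr (_ * _); apply: eq_bigr => a _; rewrite addrAC. Qed.

(** The power v^(-1/4). Being characterized by [quartic_invX4], it can be compared with [b] through
    polynomial inequalities. *)
Definition quartic_inv (R : realType) (v : R) : R := (Num.sqrt (Num.sqrt v))^-1.

Lemma quartic_inv_gt0 (R : realType) (v : R) : 0 < v -> 0 < quartic_inv v.
Proof. by move=> v0; rewrite invr_gt0 !sqrtr_gt0. Qed.

Lemma quartic_invX4 (R : realType) (v : R) : 0 < v -> quartic_inv v ^+ 4 * v = 1.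
Proof.
move=> v0; rewrite exprVn (exprM _ 2 2) !sqr_sqrtr ?sqrtr_ge0 ?(ltW v0)//.
by rewrite mulVf ?gt_eqF.
Qed.

Lemma quartic_inv_le (R : realType) (v b : R) : 0 < v -> 0 < b ->
  1 <= b ^+ 4 * v -> quartic_inv v <= b.
Proof.
move=> v0 b0 bv; have q0 := quartic_inv_gt0 v0.
rewrite -(@ler_pXn2r _ 4 isT) ?nnegrE; [|exact: ltW|exact: ltW].
by rewrite -(ler_pM2r v0) quartic_invX4.
Qed.

Lemma quartic_inv_ge (R : realType) (v b : R) : 0 < v -> 0 < b ->
  b ^+ 4 * v <= 1 -> b <= quartic_inv v.
Proof.
move=> v0 b0 bv; have q0 := quartic_inv_gt0 v0.
rewrite -(@ler_pXn2r _ 4 isT) ?nnegrE; [|exact: ltW|exact: ltW].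
by rewrite -(ler_pM2r v0) quartic_invX4.
Qed.

(** The Taylor coefficient of e^2 in (1 + e)^(-1/4) is 5/32 < 33/200, and the slack absorbs the
    higher terms. *)
Lemma quartic_inv_taylor (R : realType) (v e : R) : 0 < v ->
  - (1 / 100) <= e <= 1 / 100 ->
  quartic_inv (v * (1 + e)) <= quartic_inv v * (1 - e / 4 + 33 / 200 * e ^+ 2).
Proof.
move=> v0 /andP[e1 e2]; have q0 := quartic_inv_gt0 v0.
have e20 : 0 <= e ^+ 2 by rewrite sqr_ge0.
set p := 1 - e / 4 + _; have p0 : 0 < p by rewrite /p; lra.
have pe : 1 <= p ^+ 4 * (1 + e).
  have e3 : e ^+ 3 <= 1 / 100 * e ^+ 2 by rewrite exprS ler_wpM2r.
  have e3' : - (1 / 100) * e ^+ 2 <= e ^+ 3 by rewrite exprS ler_wpM2r.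
  have e4 : 0 <= e ^+ 4 by rewrite exprn_even_ge0.
  (* The polynomial [p] is squared twice, each time rounding the coefficient of e^2 down to absorb
     the cubic term. *)
  pose m := 1 - e / 2 + 39 / 100 * e ^+ 2.
  have m0 : 0 <= m by rewrite /m; lra.
  have pm : m <= p ^+ 2.
    have -> : p ^+ 2 = 1 - e / 2 + (1 / 16 + 33 / 100) * e ^+ 2 -
        33 / 400 * e ^+ 3 + (33 / 200) ^+ 2 * e ^+ 4 by rewrite /p; field.
    have : 0 <= (33 / 200) ^+ 2 * e ^+ 4 by rewrite mulr_ge0// sqr_ge0.
    by rewrite /m; lra.
  have pm2 : 1 - e + 102 / 100 * e ^+ 2 <= p ^+ 4.
    apply: (@le_trans _ _ (m ^+ 2)); last first.
      by rewrite (exprM p 2 2) ler_pXn2r ?nnegrE ?sqr_ge0.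
    have -> : m ^+ 2 = 1 - e + (1 / 4 + 78 / 100) * e ^+ 2 -
        39 / 100 * e ^+ 3 + (39 / 100) ^+ 2 * e ^+ 4 by rewrite /m; field.
    have : 0 <= (39 / 100) ^+ 2 * e ^+ 4 by rewrite mulr_ge0// sqr_ge0.
    lra.
  apply: le_trans (ler_wpM2r _ pm2); last by lra.
  have -> : (1 - e + 102 / 100 * e ^+ 2) * (1 + e) =
      1 + 2 / 100 * e ^+ 2 + 102 / 100 * e ^+ 3 by field.
  lra.
have v1 : 0 < v * (1 + e) by rewrite mulr_gt0//; lra.
apply: quartic_inv_le => //; first by rewrite mulr_gt0.
have -> : (quartic_inv v * p) ^+ 4 * (v * (1 + e)) =
   (quartic_inv v ^+ 4 * v) * (p ^+ 4 * (1 + e)) by rewrite exprMn; ring.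
by rewrite quartic_invX4// mul1r.
Qed.

(** Convexity of (1 - e)^(-1/4) at e = 1/v, checked through 1 - e <= (1 - e/2)^2. *)
Lemma quartic_inv_pred (R : realType) (v : R) : 1 < v ->
  quartic_inv v * (1 + v^-1 / 4) <= quartic_inv (v - 1).
Proof.
move=> v1; have v0 : 0 < v by lra.
have q0 := quartic_inv_gt0 v0; have vi0 : 0 < v^-1 by rewrite invr_gt0.
have vi1 : v^-1 < 1 by rewrite invf_lt1.
apply: quartic_inv_ge; [lra|by rewrite mulr_gt0//; lra|].
have -> : v - 1 = v * (1 - v^-1) by rewrite mulrBr mulr1 divff ?gt_eqF.
have -> : (quartic_inv v * (1 + v^-1 / 4)) ^+ 4 * (v * (1 - v^-1)) =
   (quartic_inv v ^+ 4 * v) * ((1 + v^-1 / 4) ^+ 4 * (1 - v^-1)).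
  by rewrite exprMn; ring.
rewrite quartic_invX4// mul1r; move: vi0 vi1; set e := v^-1 => e0 e1.
have h : (1 + e / 4) ^+ 2 * (1 - e / 2) <= 1.
  have -> : (1 + e / 4) ^+ 2 * (1 - e / 2) = 1 - 3 / 16 * e ^+ 2 - e ^+ 3 / 32.
    by field.
  have : 0 <= e ^+ 2 by rewrite sqr_ge0.
  have : 0 <= e ^+ 3 by rewrite exprn_ge0// ltW.
  lra.
have h2 : 1 - e <= (1 - e / 2) ^+ 2.
  have -> : (1 - e / 2) ^+ 2 = 1 - e + (e / 2) ^+ 2 by field.
  by rewrite lerDl sqr_ge0.
apply: (@le_trans _ _ (((1 + e / 4) ^+ 2 * (1 - e / 2)) ^+ 2)).
  rewrite exprMn -exprM ler_wpM2l// exprn_ge0//; lra.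
rewrite expr_le1// mulr_ge0 ?sqr_ge0//; lra.
Qed.

Definition sqn (R : realType) (d : nat) (x : 'rV[int]_d) : R :=
  \sum_(i < d) (x 0 i)%:~R ^+ 2.

Lemma sqn_ge0 (R : realType) (d : nat) (x : 'rV[int]_d) : 0 <= sqn R x.
Proof. by apply: sumr_ge0 => i _; rewrite sqr_ge0. Qed.

Lemma sqn_coord (R : realType) (d : nat) (x : 'rV[int]_d) i :
  ((x 0 i)%:~R : R) ^+ 2 <= sqn R x.
Proof.
rewrite /sqn (bigD1 i)//= lerDl; apply: sumr_ge0 => j _; exact: sqr_ge0.
Qed.

Lemma sqn_step (R : realType) (d : nat) (x : 'rV[int]_d) i b :
  sqn R (x + walk_step (i, b)) = sqn R x + 1 + (-1) ^+ (~~ b) * 2 * (x 0 i)%:~R.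
Proof.
rewrite /sqn (bigD1 i)//= [in RHS](bigD1 i)//=.
rewrite [in LHS](eq_bigr (fun j => (x 0 j)%:~R ^+ 2)).
  rewrite /walk_step; case: b; rewrite /= !mxE !eqxx /=.
    by rewrite expr0 intrD; ring.
  by rewrite expr1 intrD intrN; ring.
move=> j ji; rewrite /walk_step; case: b; rewrite /= !mxE eqxx (negbTE ji) /=.
  by rewrite addr0.
by rewrite subr0.
Qed.

(* An exponent 1/4 < (d - 2) / 2 makes this superharmonic far from the origin
   when d >= 3; the constant [100 ^+ 2] makes it so everywhere. *)
Definition potential (R : realType) (d : nat) (x : 'rV[int]_d) : R :=
  quartic_inv (100 ^+ 2 + sqn R x).

Lemma potential_ge0 (R : realType) (d : nat) (x : 'rV[int]_d) : 0 <= potential R x.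
Proof. by rewrite invr_ge0 sqrtr_ge0. Qed.

(** The arguments at the two neighbours are v (1 + e) and v (1 - e) with e = 2 x_i / v, so the
    linear terms cancel. The constant 100^2 gives |e| <= 1/100. *)
Lemma potential_pair (R : realType) (d : nat) (x : 'rV[int]_d) (i : 'I_d)
    (v : R) : v = 100 ^+ 2 + sqn R x + 1 ->
  potential R (x + walk_step (i, true)) + potential R (x + walk_step (i, false))
  <= quartic_inv v * (2 + 132 / 100 * (x 0 i)%:~R ^+ 2 / v ^+ 2).
Proof.
move=> vE; have s0 := sqn_ge0 R x.
have v0 : 0 < v by lra.
rewrite /potential !sqn_step /= expr0 expr1.
set z : R := (x 0 i)%:~R.
have zs : z ^+ 2 <= sqn R x by exact: sqn_coord.
pose e := 2 * z / v.
have ve : v * e = 2 * z by rewrite /e mulrC divfK ?gt_eqF.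
have z1 : 200 * z <= v.
  have : 0 <= (z - 100) ^+ 2 by rewrite sqr_ge0.
  by rewrite sqrrB vE; lra.
have z2 : - v <= 200 * z.
  have : 0 <= (z + 100) ^+ 2 by rewrite sqr_ge0.
  by rewrite sqrrD vE; lra.
have e1 : e <= 1 / 100 by rewrite /e ler_pdivrMr//; lra.
have e2 : - (1 / 100) <= e by rewrite /e ler_pdivlMr//; lra.
have -> : 100 ^+ 2 + (sqn R x + 1 + 1 * 2 * z) = v * (1 + e).
  by rewrite [v * (1 + _)]mulrDr ve vE; ring.
have -> : 100 ^+ 2 + (sqn R x + 1 + -1 * 2 * z) = v * (1 + - e).
  by rewrite [v * (1 + _)]mulrDr mulrN ve vE; ring.
have h1 := @quartic_inv_taylor R v e v0; have h2 := @quartic_inv_taylor R v (- e) v0.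
apply: le_trans (lerD (h1 _) (h2 _)) _; [by rewrite e2|by lra|].
rewrite -mulrDr (ler_wpM2l (ltW (quartic_inv_gt0 v0)))//.
have -> : 132 / 100 * z ^+ 2 / v ^+ 2 = 33 / 100 * e ^+ 2.
  by rewrite /e; field; rewrite gt_eqF.
by rewrite sqrrN; lra.
Qed.

(** For d >= 3 averaging costs at most a factor 1 + (22/100) / v, whereas replacing v by v - 1 gains
    1 + (1/4) / v. The difference 3/100 of the coefficients gives [c] at the origin. *)
Lemma potential_superharmonic (R : realType) (d : nat) : (3 <= d)%N ->
  exists2 c : R, 0 < c & forall x : 'rV[int]_d,
    walk_op (@potential R d) x + c *+ (x == 0) <= potential R x.
Proof.
move=> d3; have d0 : (0 < d)%N by apply: leq_trans d3.
pose w : R := 100 ^+ 2 + 1.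
have w0 : 0 < w by rewrite /w; lra.
exists (3 / 100 * (quartic_inv w / w)) => [|x].
  by rewrite mulr_gt0 ?divr_gt0 ?quartic_inv_gt0.
have s0 := sqn_ge0 R x.
pose v : R := 100 ^+ 2 + sqn R x + 1.
have v1 : 1 < v by rewrite /v; lra.
have v0 : 0 < v by lra.
have q0 := quartic_inv_gt0 v0.
have vi0 : 0 < v^-1 by rewrite invr_gt0.
have hop : walk_op (@potential R d) x <= quartic_inv v * (1 + 22 / 100 * v^-1).
  rewrite /walk_op.
  rewrite -(pair_big xpredT xpredT (fun i b => potential R (x + walk_step (i, b))))/=.
  have dR : 0 < (2 * d)%N%:R :> R by rewrite ltr0n muln_gt0.
  rewrite mulrC ler_pdivrMr//.
  under eq_bigr do rewrite big_bool /=.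
  apply: (@le_trans _ _ (\sum_(i < d) quartic_inv v *
      (2 + 132 / 100 * (x 0 i)%:~R ^+ 2 / v ^+ 2))).
    by apply: ler_sum => i _; exact: (@potential_pair _ _ _ _ v).
  rewrite -mulr_sumr -[leRHS]mulrA (ler_wpM2l (ltW q0))//.
  rewrite big_split /= sumr_const card_ord -mulr_suml -mulr_sumr -/(sqn R x).
  rewrite -[2 *+ d]mulr_natr [(2 * d)%N%:R]natrM.
  have -> : (1 + 22 / 100 * v^-1) * (2 * d%:R) = 2 * d%:R + 22 / 100 / v * (2 * d%:R).
    by ring.
  rewrite lerD2l.
  have d3R : 3 <= d%:R :> R by rewrite ler_nat.
  apply: (@le_trans _ _ (132 / 100 * v^-1)).
    rewrite -mulrA ler_wpM2l//.
    rewrite ler_pdivrMr ?exprn_gt0// expr2 mulrA mulVf ?gt_eqF// mul1r /v; lra.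
  have -> : 22 / 100 / v * (2 * d%:R) = (44 / 100 * d%:R) * v^-1 by ring.
  by rewrite (ler_wpM2r (ltW vi0))//; lra.
apply: (@le_trans _ _ (quartic_inv v * (1 + v^-1 / 4))); last first.
  have -> : potential R x = quartic_inv (v - 1) by rewrite /v addrK.
  exact: quartic_inv_pred.
have -> : quartic_inv v * (1 + v^-1 / 4) =
  quartic_inv v * (1 + 22 / 100 * v^-1) + 3 / 100 * (quartic_inv v / v).
  by field; rewrite gt_eqF.
apply: lerD => //; have [x0|_] := eqVneq x 0; last first.
  by rewrite mulr0n mulr_ge0// mulr_ge0// ltW.
rewrite mulr1n; suff -> : v = w by [].
rewrite /v /w /sqn x0 big1 ?addr0// => i _; rewrite mxE mulr0z expr0n//.
Qed.

(** The decay is |x|^(-1/2). The form [2 * sqn R x] is the sum of squares of the [s] and [t]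
    coordinates of a point of the plane. *)
Lemma potential_decay (R : realType) (d : nat) (x : 'rV[int]_d) (n : nat) :
  (16 ^+ n) ^+ 2 <= 2 * sqn R x -> potential R x <= 2 / 4 ^+ n.
Proof.
move=> h; have s0 := sqn_ge0 R x.
have p0 : 0 < (4 : R) ^+ n by rewrite exprn_gt0.
have v0 : 0 < 100 ^+ 2 + sqn R x by lra.
apply: quartic_inv_le => //.
rewrite exprMn exprVn mulrAC ler_pdivlMr ?exprn_gt0// mul1r.
have -> : (4 ^+ n) ^+ 4 = ((16 : R) ^+ n) ^+ 2.
  have -> : (16 : R) = 4 ^+ 2 by ring.
  by rewrite -!exprM; congr (_ ^+ _); lia.
lra.
Qed.

(** * Lower bound on the capacity *)

(* Probability that the walk started at x avoids K during the times 1, ..., n. *)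
Fixpoint escape (R : realType) (d : nat) (K : {fset 'rV[int]_d}) (n : nat)
    (x : 'rV[int]_d) : R :=
  if n is n'.+1 then
    walk_op (fun y => if y \in K then 0 else escape R K n' y) x
  else 1.

Lemma escape_ge0 (R : realType) (d : nat) (K : {fset 'rV[int]_d}) n x :
  0 <= escape R K n x.
Proof.
elim: n x => [|n IH] x //=; rewrite mulr_ge0 ?invr_ge0// sumr_ge0// => a _.
by case: ifP.
Qed.

(* Last exit decomposition: a summand on the left is the probability that K is
   visited during the times 0, ..., n, and the mean number of visits to y is at
   most [G (x - y) / c]. *)
Lemma escape_potential (R : realType) (d : nat) (K : {fset 'rV[int]_d})
    (G : 'rV[int]_d -> R) (c : R) (N : nat) (x : 'rV[int]_d) :
  (0 < d)%N -> 0 <= c -> (forall x, 0 <= G x) ->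
  (forall x, walk_op G x + c *+ (x == 0) <= G x) ->
  c * \sum_(n < N) (1 - (if x \in K then 0 else escape R K n x)) <=
  \sum_(y <- K) (\sum_(n < N) escape R K n y) * G (x - y).
Proof.
move=> d0 c0 G0 Gc.
pose r n y := if y \in K then 0 else escape R K n y.
pose F N y := \sum_(n < N) escape R K n y.
have F_ge0 k y : 0 <= F k y by apply: sumr_ge0 => i _; exact: escape_ge0.
rewrite -/(F N); elim: N x => [|N IH] x.
  by rewrite big_ord0 mulr0; apply: sumr_ge0 => y _; exact: mulr_ge0 (F_ge0 _ _) (G0 _).
have FS y : F N y <= F N.+1 y by rewrite /F big_ord_recr lerDl escape_ge0.
pose S N y := \sum_(n < N) (1 - r n y).
have IH' y : c * S N y <= \sum_(z <- K) F N.+1 z * G (y - z).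
  apply: le_trans (IH y) _; apply: ler_sum => z _.
  exact: (ler_wpM2r (G0 _) (FS z)).
(* One step of the walk turns [r n] into [escape] at [n.+1], and the term of index 0 vanishes. On
   [K], where [r] is 0, the sum of the [escape] terms is added back. *)
have step : S N.+1 x = (if x \in K then F N.+1 x else 0) + walk_op (S N) x.
  have wS : walk_op (S N) x = \sum_(n < N) (1 - escape R K n.+1 x).
    rewrite /S walk_op_sum; apply: eq_bigr => n _.
    have -> : (fun y => 1 - r n y) = (fun y => 1 + -1 * r n y).
      by apply/funext => y; rewrite mulN1r.
    by rewrite walk_opD walk_op_cst// walk_opZ mulN1r.
  have -> : walk_op (S N) x = \sum_(n < N.+1) (1 - escape R K n x).
    by rewrite wS big_ord_recl /= subrr add0r.
  case: ifPn => xK; rewrite /S /F -?big_split /=.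
    by apply: eq_bigr => n _; rewrite /r xK subr0 addrC subrK.
  by rewrite add0r; apply: eq_bigr => n _; rewrite /r (negbTE xK).
rewrite -/(S N.+1 x) step mulrDr.
(* Spreading this term over [K] lets the superharmonicity of [G] apply to each [y] separately. *)
have -> : (if x \in K then F N.+1 x else 0) = \sum_(y <- K) F N.+1 y *+ (x - y == 0).
  case: ifPn => xK.
    rewrite (bigD1_seq x)//= ?fset_uniq// subr_eq0 eqxx big1 ?addr0// => y yx.
    by rewrite subr_eq0 eq_sym (negbTE yx).
  rewrite big_seq big1// => y yK; rewrite subr_eq0.
  by case: eqVneq xK => // ->; rewrite yK.
rewrite mulr_sumr -walk_opZ.
apply: (le_trans (lerD (lexx _) (walk_op_le _ IH'))).
rewrite walk_op_sum -big_split /=; apply: ler_sum => y _.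
rewrite walk_opZ (@walk_op_shift R d G) addrC mulrnAr [c * _]mulrC -mulrnAr -mulrDr.
exact: (ler_wpM2l (F_ge0 _ _) (Gc _)).
Qed.

(** Sum of [escape_potential] over starting points in [K], which are visited at time 0, so that
    every summand on the left is 1. *)
Lemma sum_escape_ge (R : realType) (d : nat) (K : {fset 'rV[int]_d})
    (G : 'rV[int]_d -> R) (c B : R) (N : nat) :
  (0 < d)%N -> 0 <= c -> (forall x, 0 <= G x) ->
  (forall x, walk_op G x + c *+ (x == 0) <= G x) ->
  (forall y, y \in K -> \sum_(x <- K) G (x - y) <= B) ->
  c * (#|` K| * N)%N%:R <= B * \sum_(y <- K) \sum_(n < N) escape R K n y.
Proof.
move=> d0 c0 G0 Gc GB.
have h : c * (#|` K| * N)%N%:R <=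
    \sum_(x <- K) \sum_(y <- K) (\sum_(n < N) escape R K n y) * G (x - y).
  apply: (@le_trans _ _ (\sum_(x <- K) c * N%:R)).
    by rewrite big_const_seq count_predT iter_addr_0 -[leRHS]mulr_natl natrM mulrCA.
  rewrite big_seq [leRHS]big_seq; apply: ler_sum => x xK.
  apply: le_trans (escape_potential K N x d0 c0 G0 Gc).
  by rewrite xK subr0 sumr_const card_ord.
apply: le_trans h _; rewrite exchange_big mulr_sumr /= big_seq [leRHS]big_seq.
apply: ler_sum => y yK; rewrite -mulr_sumr mulrC ler_wpM2r ?GB//.
by apply: sumr_ge0 => n _; exact: escape_ge0.
Qed.

(** * From the recursion for [escape] to the random walk *)

Lemma walk_step_inj (d : nat) : injective (@walk_step d).
Proof.
move=> [i b] [j c]; rewrite /walk_step /= => e.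
have [ij|ij] := eqVneq i j.
  subst j; congr pair; move: e; case: b; case: c => //= /rowP/(_ i);
  by rewrite !mxE !eqxx.
by move: e; case: b; case: c => /= /rowP/(_ i); rewrite !mxE !eqxx (negbTE ij).
Qed.

Lemma nearest_neighbour_step (d : nat) (x : 'rV[int]_d) a :
  nearest_neighbour x (x + walk_step a).
Proof.
case: a => i b; rewrite /nearest_neighbour (bigD1 i)//= big1 => [|j ji].
  by rewrite /walk_step; case: b;
    rewrite /= !mxE !eqxx addrAC subrr add0r ?normrN normr1 addr0.
by rewrite /walk_step; case: b;
  rewrite /= !mxE eqxx (negbTE ji) addrAC subrr add0r ?oppr0 normr0.
Qed.

Lemma measure_bigcup_finType (d : measure_display) (T : measurableType d)
    (R : realType) (mu : {measure set T -> \bar R}) (I : finType) (F : I -> set T) :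
  (forall i, measurable (F i)) -> trivIset setT F ->
  mu (\bigcup_i F i) = (\sum_(i : I) mu (F i))%E.
Proof.
move=> mF tF.
have -> : \bigcup_i F i = \bigcup_(i in [set` index_enum I]) F i.
  by congr (\bigcup_(i in _) _); apply/seteqP; split=> // i _ /=; exact: mem_index_enum.
rewrite measure_fin_bigcup//; last by apply: sub_trivIset tF.
by rewrite -fsbig_seq// index_enum_uniq.
Qed.

(* Stated for a prefix g of the path, so that an induction on n needs no Markov
   property. *)
Lemma follow_avoid_ge (R : realType) (d : nat) (dispW : measure_display)
    (W : measurableType dispW) (P : probability W R)
    (X : nat -> W -> 'rV[int]_d) (x : 'rV[int]_d) (K : {fset 'rV[int]_d}) :
  simple_random_walk P X x ->
  forall (n j : nat) (g : nat -> 'rV[int]_d), g 0%N = x ->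
  (forall k, (k < j)%N -> nearest_neighbour (g k) (g k.+1)) ->
  (((2 * d)%N%:R^-1 ^+ j * escape R K n (g j))%:E <=
    P [set w | (forall k, (k <= j)%N -> X k w = g k) /\
      forall k, (j < k <= j + n)%N -> X k w \notin K])%E.
Proof.
move=> [mX PX].
pose A j g n := [set w | (forall k, (k <= j)%N -> X k w = g k) /\
      forall k, (j < k <= j + n)%N -> X k w \notin K].
have mA j g n : measurable (A j g n).
  have -> : A j g n = (\bigcap_(k in [set k | (k <= j)%N]) [set w | X k w = g k]) `&`
      \bigcap_(k in [set k | (j < k <= j + n)%N])
        ~` (\bigcup_(y in [set` K]) [set w | X k w = y]).
    apply/seteqP; split=> w [h1 h2]; split=> // k kj.
      by move=> [y /= yK Xy]; have := h2 k kj; rewrite Xy yK.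
    apply/negP => XK; apply: (h2 k kj); exists (X k w) => //.
  apply: measurableI; first by apply: bigcap_measurableType.
  apply: bigcap_measurableType => k _; apply: measurableC.
  by apply: fin_bigcup_measurable => //; exact: finite_fset.
elim=> [|n IH] j g g0 gnn; rewrite -/(A j g _).
  rewrite mulr1 -(PX j g g0 gnn); apply: le_measure; rewrite ?inE//.
    have -> : [set w | forall k, (k <= j)%N -> X k w = g k] =
      \bigcap_(k in [set k | (k <= j)%N]) [set w | X k w = g k] by [].
    by apply: bigcap_measurableType.
  move=> w h; split=> // k; rewrite addn0 => /andP[jk kj].
  by move: (leq_trans jk kj); rewrite ltnn.
(* Decomposition by the next step: [g' a] prolongs the path by the step [a]. *)
pose g' a k := if (k <= j)%N then g k else g j + walk_step a.
pose F a := if g j + walk_step a \in K then set0 else A j.+1 (g' a) n.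
have mF a : measurable (F a) by rewrite /F; case: ifP.
have tF : trivIset setT F.
  move=> a b _ _ [w []]; rewrite /F; case: ifP => // _ [/(_ j.+1 (leqnn _)) ha _].
  case: ifP => // _ [/(_ j.+1 (leqnn _)) + _]; rewrite ha /g' ltnn => /addrI.
  exact: walk_step_inj.
apply: (@le_trans _ _ (P (\bigcup_a F a))); last first.
  apply: le_measure; rewrite ?inE//.
    exact: countable_bigcupT_measurable.
  move=> w [a _]; rewrite /F; case: ifPn => // gaK [h1 h2]; split.
    by move=> k kj; rewrite h1 /g' ?kj// ltnW.
  move=> k /andP[]; rewrite leq_eqVlt => /orP[/eqP<- _|jk kjn].
    by rewrite h1// /g' ltnn.
  by apply: h2; rewrite jk addSnnS.
rewrite measure_bigcup_finType// /= /walk_op mulrA -exprSr mulr_sumr -sumEFin.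
apply: lee_sum => a _; rewrite /F; case: ifPn => gaK; first by rewrite mulr0 measure0.
have g'j : g' a j.+1 = g j + walk_step a by rewrite /g' ltnn.
have := IH j.+1 (g' a); rewrite g'j; apply; first by rewrite /g' leq0n.
move=> k; rewrite ltnS => kj; rewrite /g' kj; case: ltnP => kj'; first exact: gnn.
have -> : k = j by apply/eqP; rewrite eqn_leq kj.
exact: nearest_neighbour_step.
Qed.

(** Dividing [sum_escape_ge] by the number of times gives Cesaro means of escape probabilities,
    which converge to the summands of the capacity. *)
Lemma capacity_ge (R : realType) (d : nat) (dispW : measure_display)
    (W : measurableType dispW) (P_ : 'rV[int]_d -> probability W R)
    (X : nat -> W -> 'rV[int]_d) (K : {fset 'rV[int]_d})
    (G : 'rV[int]_d -> R) (c B : R) :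
  (forall x, simple_random_walk (P_ x) X x) ->
  (0 < d)%N -> 0 <= c -> (forall x, 0 <= G x) ->
  (forall x, walk_op G x + c *+ (x == 0) <= G x) ->
  0 <= B -> (forall y, y \in K -> \sum_(x <- K) G (x - y) <= B) ->
  c * #|` K|%:R <= B * capacity P_ X K.
Proof.
move=> srw d0 c0 G0 Gc B0 GB.
pose E n := [set w | forall k, (0 < k <= n)%N -> X k w \notin K].
pose e n y := fine (P_ y (E n)).
have mX k y : measurable [set w | X k w = y] by have [] := srw y.
have mE n : measurable (E n).
  have -> : E n = \bigcap_(k in [set k | (0 < k <= n)%N])
      ~` (\bigcup_(y in [set` K]) [set w | X k w = y]).
    apply/seteqP; split=> w h k kj.
      by move=> [y /= yK Xy]; have := h k kj; rewrite Xy yK.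
    by apply/negP => XK; apply: (h k kj); exists (X k w).
  apply: bigcap_measurableType => k _; apply: measurableC.
  by apply: fin_bigcup_measurable => //; exact: finite_fset.
have escE n y : escape R K n y <= e n y.
  have := @follow_avoid_ge R d dispW W (P_ y) X y K (srw y) n 0%N (fun=> y) erefl.
  rewrite expr0 mul1r => h; rewrite -lee_fin /e fineK ?fin_num_measure//.
  apply: le_trans (h _) _ => //.
  have -> : [set w | (forall k, (k <= 0)%N -> X k w = y) /\
      forall k, (0 < k <= 0 + n)%N -> X k w \notin K] = [set w | X 0%N w = y] `&` E n.
    apply/seteqP; split=> w [h1 h2]; split=> //; first exact: h1.
    by move=> k; rewrite leqn0 => /eqP->.
  by apply: le_measure; rewrite ?inE//; exact: measurableI.
pose Einf := [set w | forall k, (0 < k)%N -> X k w \notin K].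
have EinfE : Einf = \bigcap_n E n.
  apply/seteqP; split=> w h; first by move=> n _ k /andP[k0 _]; exact: h.
  by move=> k k0; apply: (h k) => //; rewrite k0 /=.
have ecvg y : (fun n => e n y) @ \oo --> (fine (P_ y Einf) : R).
  apply: fine_cvg; rewrite EinfE fineK ?fin_num_measure//; last first.
    exact: bigcap_measurableType.
  apply: nonincreasing_cvg_mu => //.
  - exact: (le_lt_trans (probability_le1 _ _)) (ltry _).
  - exact: bigcap_measurableType.
  - move=> m n mn; apply/subsetPset => w h k /andP[k0 km]; apply: h.
    by rewrite k0 (leq_trans km).
have meancvg : (fun N => B * \sum_(y <- K) arithmetic_mean (e ^~ y) N) @ \oo
    --> B * capacity P_ X K.
  apply: cvgMr; rewrite /capacity.
  elim: (enum_fset K) => [|z s IH].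
    under eq_fun do rewrite big_nil.
    by rewrite big_nil; exact: cvg_cst.
  under eq_fun do rewrite big_cons.
  by rewrite big_cons; apply: cvgD => //; exact: (cesaro (ecvg z)).
apply: (cvgr_to_ge meancvg); near=> N.
have N0 : 0 < N.+1%:R :> R by rewrite ltr0n.
rewrite -(ler_pM2r N0) -mulrA -natrM.
apply: le_trans (@sum_escape_ge R d K G c B N.+1 d0 c0 G0 Gc GB) _.
rewrite -mulrA ler_wpM2l// mulr_suml; apply: ler_sum => y _.
rewrite /arithmetic_mean /= mulrAC mulVf ?gt_eqF// mul1r /series /= big_mkord.
by apply: ler_sum => n _; exact: escE.
Unshelve. all: by end_near. Qed.

(** * Potential and capacity of spread sets *)

Lemma sqn_plane (R : realType) (d : nat) (z w : int * int) : (2 <= d)%N ->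
  2 * sqn R (plane_embedding d z - plane_embedding d w) =
  ((scoord z - scoord w) ^+ 2 + (tcoord z - tcoord w) ^+ 2)%:~R.
Proof.
case: d => [|[|d]]// _; rewrite /sqn !big_ord_recl big1 => [|i _].
  rewrite !mxE /= /scoord /tcoord; case: z => a b; case: w => a' b' /=.
  by rewrite addr0 -!rmorphXn -rmorphD -[2]/(2%:~R) -rmorphM; congr (_%:~R); lia.
by rewrite !mxE /= subr0 expr0n.
Qed.

Lemma far_sym n z w : far n z w = far n w z.
Proof. by rewrite /far distrC [in X in _ || X]distrC. Qed.

Lemma far_potential (R : realType) (d n : nat) (z w : int * int) : (2 <= d)%N ->
  far n w z ->
  potential R (plane_embedding d w - plane_embedding d z) <= 2 / 4 ^+ n.
Proof.
move=> d2 zw; apply: potential_decay; rewrite sqn_plane//.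
have -> : ((16 : R) ^+ n) ^+ 2 = ((box_width n)%:Z ^+ 2)%:~R.
  by rewrite rmorphXn /= -pmulrn natrX.
rewrite ler_int; case/orP: zw => h.
  rewrite -[leRHS]addr0; nia.
nia.
Qed.

(** Passing from [n] to [n.+1] adds 2^n sites of potential at most 2 / 4^n, so 2 / 2^n in total,
    which is exactly the growth of the bound. *)
Lemma spread_potential (R : realType) (d n : nat) (l : seq (int * int)) z :
  (2 <= d)%N -> spread n l -> z \in l ->
  \sum_(w <- l) potential R (plane_embedding d w - plane_embedding d z)
  <= 6 - 4 / 2 ^+ n.
Proof.
move=> d2; elim: n l => [|n IH] l.
  move=> /eqP; case: l => [|w []]// _; rewrite inE => /eqP->.
  rewrite big_seq1 subrr expr0; have s0 := sqn_ge0 R (0 : 'rV[int]_d).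
  apply: (@le_trans _ _ 2); last by lra.
  by apply: quartic_inv_le; lra.
rewrite [spread _ _]/=; have := cat_take_drop (2 ^ n) l.
set l1 := take _ _; set l2 := drop _ _ => <- /and3P[s1 s2 /allrelP f].
have p2 : 0 < (2 ^+ n)^-1 :> R by rewrite invr_gt0 exprn_gt0.
have other l' : size l' = (2 ^ n)%N -> (forall w, w \in l' -> far n w z) ->
    \sum_(w <- l') potential R (plane_embedding d w - plane_embedding d z)
      <= 2 / 2 ^+ n.
  move=> sz fr; apply: (@le_trans _ _ (\sum_(w <- l') 2 / 4 ^+ n)).
    rewrite big_seq [leRHS]big_seq; apply: ler_sum => w wl.
    by apply: far_potential => //; exact: fr.
  rewrite big_const_seq count_predT iter_addr_0 sz.
  rewrite -[leLHS]mulr_natr [(2 ^ n)%N%:R]natrX.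
  have -> : (4 : R) ^+ n = 2 ^+ n * 2 ^+ n by rewrite -exprMn; congr (_ ^+ _); ring.
  by rewrite invfM -!mulrA mulVf ?mulr1// expf_neq0.
rewrite mem_cat big_cat/= exprS invfM => /orP[zl|zl].
  have h1 := IH _ s1 zl.
  have h2 : \sum_(w <- l2) potential R (plane_embedding d w - plane_embedding d z)
      <= 2 / 2 ^+ n.
    by apply: other (spread_size s2) _ => w wl; rewrite far_sym; exact: f.
  lra.
have h1 : \sum_(w <- l1) potential R (plane_embedding d w - plane_embedding d z)
    <= 2 / 2 ^+ n.
  by apply: other (spread_size s1) _ => w wl; exact: f.
have h2 := IH _ s2 zl.
lra.
Qed.

Lemma spread_uniq n l : spread n l -> uniq l.
Proof.
elim: n l => [|n IH] l; first by move=> /eqP; case: l => [|w []].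
rewrite [spread _ _]/=; have := cat_take_drop (2 ^ n) l.
set l1 := take _ _; set l2 := drop _ _ => <- /and3P[/IH u1 /IH u2 /allrelP f].
rewrite cat_uniq u1 u2 andbT /=; apply/hasPn => w w2; apply/negP => /= w1.
have := f _ _ w1 w2; have := box_width_gt0 n; rewrite /far; lia.
Qed.

Lemma plane_embedding_inj (d : nat) : (2 <= d)%N -> injective (plane_embedding d).
Proof.
case: d => [|[|d]]// _ [a b] [a' b'] /rowP e.
have := e ord0; have := e (lift ord0 ord0).
by rewrite !mxE /= => -> ->.
Qed.

Definition plane_fset (d : nat) (l : seq (int * int)) : {fset 'rV[int]_d} :=
  [fset plane_embedding d z | z in l]%fset.

Lemma perm_plane_fset (d : nat) (l : seq (int * int)) : (2 <= d)%N -> uniq l ->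
  perm_eq (plane_fset d l) [seq plane_embedding d z | z <- l].
Proof.
move=> d2 ul; apply: uniq_perm.
- exact: fset_uniq.
- by rewrite map_inj_uniq//; exact: plane_embedding_inj.
move=> x; apply/imfsetP/mapP => -[z zl ->]; by exists z.
Qed.

Lemma capacity_spread (R : realType) (d : nat) : (3 <= d)%N ->
  exists2 c : R, 0 < c & forall (dispW : measure_display)
    (W : measurableType dispW) (P_ : 'rV[int]_d -> probability W R)
    (X : nat -> W -> 'rV[int]_d),
  (forall x, simple_random_walk (P_ x) X x) ->
  forall n l, spread n l -> c * 2 ^+ n <= capacity P_ X (plane_fset d l).
Proof.
move=> d3; have d2 : (2 <= d)%N by apply: leq_trans d3.
have [c c0 cG] := potential_superharmonic R d3.
exists (c / 6); first by rewrite divr_gt0.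
move=> dispW W P_ X srw n l sl; have ul := spread_uniq sl.
rewrite mulrAC ler_pdivrMr// [leRHS]mulrC.
have -> : (2 : R) ^+ n = #|` plane_fset d l|%:R.
  by rewrite (perm_size (perm_plane_fset d2 ul)) size_map (spread_size sl) natrX.
apply: (capacity_ge srw _ _ (@potential_ge0 R d) cG); rewrite ?ler0n//.
- exact: leq_trans d3.
- exact: ltW.
move=> y; rewrite (perm_big _ (perm_plane_fset d2 ul)) big_map /=.
rewrite (perm_mem (perm_plane_fset d2 ul)) => /mapP[z zl ->].
apply: le_trans (spread_potential R d2 sl zl) _.
by rewrite lerBlDr lerDl divr_ge0// exprn_ge0.
Qed.

(** * Percolation *)

Fixpoint open_path (A : int * int -> Prop) (n : nat) (z : int * int) : Prop :=
  if n is n'.+1 then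
    A z /\ (open_path A n' (z.1, z.2 + 1) \/ open_path A n' (z.1 + 1, z.2))
  else A z.

Lemma open_pathS A n z : open_path A n.+1 z -> open_path A n z.
Proof.
elim: n z => [|n IH] z; first by case.
case=> Az h; split=> //.
by case: h => /IH; [left|right].
Qed.

Lemma open_path_le A m n z : (m <= n)%N -> open_path A n z -> open_path A m z.
Proof.
move/subnK <-; elim: (n - m)%N => // k IH h; apply: IH.
exact: open_pathS.
Qed.

(** König's lemma. The right-hand side involves only countably many sites and lengths, which yields
    measurability. *)
Lemma infinite_open_path (A : int * int -> Prop) :
  (exists f, oriented_path f /\ forall n, A (f n)) <->
  exists z, forall n, open_path A n z.
Proof.
split=> [[f [of_ fA]]|[z zA]].
  exists (f 0%N) => n; elim: n 0%N => [|n IH] k //=; split=> //.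
  have := IH k.+1; have -> : f k.+1 = f k + (f k.+1 - f k) by rewrite addrC subrK.
  case: (of_ k) => ->; case: (f k) => a b h; [left|right]; move: h;
    by congr open_path; congr pair; rewrite /= ?addr0.
pose inf z := forall n, open_path A n z.
pose next (z : int * int) : int * int :=
  if pselect (inf (z.1, z.2 + 1)) then (z.1, z.2 + 1) else (z.1 + 1, z.2).
have infS y : inf y -> inf (next y).
  (* If the upper neighbour fails at length [m], every open path longer than [m] has to go right. *)
  move=> infy; rewrite /next; case: pselect => //= ninf n; have /existsNP[m nm] := ninf.
  have [_ [h|h]] := infy (maxn m n).+1.
    by case: nm; apply: open_path_le h; exact: leq_maxl.
  by apply: open_path_le h; exact: leq_maxr.
pose f n := iter n next z.
exists f; split=> n.
  rewrite /f iterS; move: (iter n next z) => -[a b]; rewrite /next.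
  by case: pselect => h /=; [left|right]; congr pair; rewrite /= ?subrr// addrC addKr.
have : inf (f n) by elim: n => // n; exact: infS.
by move=> /(_ 0%N).
Qed.

Lemma measurable_percolation (d : measure_display) (T : measurableType d)
    (A : T -> int * int -> Prop) : (forall z, measurable [set t | A t z]) ->
  measurable [set t | exists f, oriented_path f /\ forall n, A t (f n)].
Proof.
move=> mA.
have mop n z : measurable [set t | open_path (A t) n z].
  elim: n z => [|n IH] z //=.
  apply: (@measurableI _ _ [set t | A t z]
    ([set t | open_path (A t) n (z.1, z.2 + 1)] `|`
     [set t | open_path (A t) n (z.1 + 1, z.2)])) => //.
  exact: measurableU.
have -> : [set t | exists f, oriented_path f /\ forall n, A t (f n)] =
    \bigcup_z \bigcap_n [set t | open_path (A t) n z].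
  apply/seteqP; split=> t.
    by move=> /infinite_open_path[z zA]; exists z => // n _; exact: zA.
  by move=> [z _ zA]; apply/infinite_open_path; exists z => n; exact: zA.
apply: countable_bigcupT_measurable => [|z]; first exact: countableP.
exact: bigcap_measurableType.
Qed.

Lemma measure_bigsetU_le (d : measure_display) (T : measurableType d) (R : realType)
    (mu : {measure set T -> \bar R}) (I : eqType) (s : seq I) (F : I -> set T) (p : R) :
  (forall i, measurable (F i)) -> (forall i, i \in s -> (mu (F i) <= p%:E)%E) ->
  (mu (\big[setU/set0]_(i <- s) F i) <= ((size s)%:R * p)%:E)%E.
Proof.
move=> mF; elim: s => [|i s IH] Fp; first by rewrite big_nil measure0 mul0r.
rewrite big_cons /= -natr1 mulrDl mul1r addrC EFinD.
apply: le_trans (measureU2 _ _ _) _ => //; first exact: bigsetU_measurable.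
apply: leeD; first by rewrite Fp ?mem_head.
by apply: IH => j js; rewrite Fp ?in_cons ?js ?orbT.
Qed.

Lemma vacant_tree_rooted V N :
  ~ (exists f, oriented_path f /\ forall n, ~ V (f n)) ->
  exists n l, [/\ (N <= n)%N, l \in rooted_trees n, spread n l &
    forall z, z \in l -> V z].
Proof.
move=> /(vacant_tree N)[n [v [l [Nn vsq lt sl Vl]]]].
by exists n, l; split=> //; apply/flatten_mapP; exists v.
Qed.

Theorem theorem2p10 (R : realType) (d : nat) (hd : (3 <= d)%N) :
  exists2 u0 : R, 0 <= u0 &
  forall (u : R), u0 <= u ->
  forall (dispW : measure_display) (W : measurableType dispW)
    (P_ : 'rV[int]_d -> probability W R) (X : nat -> W -> 'rV[int]_d),
  (forall x, simple_random_walk (P_ x) X x) ->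
  forall (dispT : measure_display) (T : measurableType dispT)
    (P : probability T R) (I : T -> set 'rV[int]_d),
  random_interlacement (capacity P_ X) u P I ->
  P [set t | exists f : nat -> int * int,
       oriented_path f /\ forall n, I t (plane_embedding d (f n))] = 1%E.
Proof.
have [c c0 capc] := capacity_spread R hd.
have [Y Y0 sizeY] := size_rooted_trees.
have YR : 0 < Y%:R :> R by rewrite ltr0n.
(* This makes Y exp(- u c) at most 1/2, by exp x >= 1 + x. *)
exists (2 * Y%:R / c); first by rewrite divr_ge0 ?ltW// mulr_gt0.
move=> u uu dispW W P_ X srw dispT T P I [mI PI].
have uc : 2 * Y%:R <= u * c by rewrite -ler_pdivrMr.
have u0 : 0 <= u by apply: le_trans uu; rewrite divr_ge0 ?ltW// mulr_gt0.
set perc := [set t | _].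
have mperc : measurable perc.
  exact: (@measurable_percolation _ _ (fun t z => I t (plane_embedding d z))).
pose vac l := [set t | I t `&` [set` plane_fset d l] = set0].
have mvac l : measurable (vac l).
  have -> : vac l = ~` (\bigcup_(x in [set` plane_fset d l]) [set t | I t x]).
    apply/seteqP; split=> t.
      by move=> h [x xl Ix]; have : set0 x by rewrite -h; split.
    by move=> h; rewrite /vac /= -subset0 => x [Ix xl]; apply: h; exists x.
  by apply: measurableC; apply: fin_bigcup_measurable => //; exact: finite_fset.
pose bad n := \big[setU/set0]_(l <- [seq l <- rooted_trees n | spread n l]) vac l.
have mbad n : measurable (bad n) by exact: bigsetU_measurable.
have Pbad n : (P (bad n) <= ((1 / 2) ^+ n)%:E)%E.
  have Pvac l : l \in [seq l <- rooted_trees n | spread n l] ->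
      (P (vac l) <= (expR (- (u * c)) ^+ (2 ^ n))%:E)%E.
    rewrite mem_filter => /andP[sl _].
    rewrite PI lee_fin -expRM_natl ler_expR mulrN lerN2 mulrCA ler_wpM2l//.
    by rewrite natrX mulrC; exact: capc.
  apply: (le_trans (measure_bigsetU_le mvac Pvac)).
  rewrite lee_fin; apply: (@le_trans _ _ ((Y%:R * expR (- (u * c))) ^+ (2 ^ n))).
    rewrite exprMn -natrX ler_wpM2r ?exprn_ge0 ?expR_ge0// ler_nat.
    by apply: leq_trans (sizeY n); rewrite size_filter count_size.
  have h : Y%:R * expR (- (u * c)) <= 1 / 2.
    rewrite expRN ler_pdivrMr ?expR_gt0//.
    have := expR_ge1Dx (u * c); lra.
  have h0 : 0 <= Y%:R * expR (- (u * c)) by rewrite mulr_ge0 ?expR_ge0.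
  apply: (@le_trans _ _ ((1 / 2) ^+ (2 ^ n))).
    by rewrite ler_pXn2r ?expn_gt0 ?nnegrE.
  by apply: ler_wiXn2l; [lra|lra|exact: ltnW (ltn_expl _ _)].
have Pn : (P (~` perc) <= 0)%E.
  apply/lee_addgt0Pr => e e0; rewrite add0e.
  pose N := Num.bound (2 / e).
  have Ne : 2 / 2 ^+ N <= e.
    rewrite ler_pdivrMr ?exprn_gt0// mulrC -ler_pdivrMr//.
    apply: le_trans (ltW (archi_boundP _)) _; first by rewrite divr_ge0// ltW.
    by rewrite -natrX ler_nat ltnW// ltn_expl.
  have cover : ~` perc `<=` \bigcup_n bad (n + N)%N.
    move=> t nperc.
    have [|n [l [Nn lr sl vl]]] :=
        @vacant_tree_rooted (fun z => ~ I t (plane_embedding d z)) N.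
      by move=> [f [of_ fI]]; apply: nperc; exists f; split=> // n; exact: contrapT.
    exists (n - N)%N => //; rewrite subnK// /bad -bigcup_seq; exists l.
      by rewrite /= mem_filter sl.
    rewrite /vac /= -subset0 => x [Ix] /imfsetP[z zl xz].
    by apply: (vl z zl); rewrite -xz.
  have sub := @measure_sigma_subadditive _ R _ P _ _
    (fun n => mbad (n + N)%N) (measurableC mperc) cover.
  (* Termwise comparison with the series of e / 2^(n+1), whose sum is at most e. *)
  apply: (le_trans sub); apply: le_trans (epsilon_trick0 xpredT (ltW e0)).
  apply: lee_nneseries => // n _; apply: le_trans (Pbad _) _.
  rewrite lee_fin div1r exprVn exprD natrX invfM exprS invfM.
  rewrite mulrC mulrA ler_wpM2r ?invr_ge0 ?exprn_ge0//.
  by rewrite ler_pdivlMr// mulrC.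
rewrite -[perc]setCK probability_setC; last exact: measurableC.
by have -> : P (~` perc) = 0%E; [apply/eqP; rewrite eq_le Pn measure_ge0|rewrite sube0].
Qed.
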